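(* The generalized Camassa-Holm equation $$u_t-u_{xxt}=u^2u_{xxx}-u^2u_{xx}-3uu_x^2-2u^2u_x+4uu_xu_{xx}+u_x^3$$ describes pseudospherical surfaces and has a universal second fundamental form; that is, there are associated 1-forms $\omega_1,\omega_2,\omega_3$ for this equation such that the pseudospherical surfaces determined by its solutions admit local isometric immersions into $\mathbb{E}^3$ whose second fundamental form has coefficients $a,b,c$ that are functions of $x$ and $t$ only, independent of $u$.
   Context: Notation. For $u(x,t)$ put $u_i=\partial_x^iu$. An equation for $u(x,t)$ describes pseudospherical surfaces, with associated 1-forms $\omega_i=f_{i1}dx+f_{i2}dt$, $1\le i\le3$, where $f_{ij}=f_{ij}(u_0,u_1,\dots,u_k)$ are differentiable functions of $u$ and its derivatives, if $d\omega_1=\omega_3\wedge\omega_2$, $d\omega_2=\omega_1\wedge\omega_3$, $d\omega_3=\omega_1\wedge\omega_2$ hold whenever $u$ is a solution for which $\omega_1\wedge\omega_2\ne0$. Such a $u$ defines a metric $I=\omega_1^2+\omega_2^2$ of Gaussian curvature $-1$. Here the 1-forms also satisfy $f_{p1}=\mu_pf_{11}+\eta_p$ with $\mu_p,\eta_p\in\mathbb{R}$, $p=2,3$. Put $\Delta_{ij}=f_{i1}f_{j2}-f_{j1}f_{i2}$; one has $\Delta_{13}^2+\Delta_{23}^2\neq0$. The second fundamental form of a local isometric immersion into $\mathbb{E}^3$ is $II=\omega_1\omega_{13}+\omega_2\omega_{23}$ with $\omega_{13}=a\omega_1+b\omega_2$, $\omega_{23}=b\omega_1+c\omega_2$; $a,b,c$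 are called its coefficients. By Bonnet's theorem the immersion exists if and only if there are $a,b,c$ with $ac-b^2=-1$ and $$f_{11}D_ta+f_{21}D_tb-f_{12}D_xa-f_{22}D_xb-2b\Delta_{13}+(a-c)\Delta_{23}=0,$$ $$f_{11}D_tb+f_{21}D_tc-f_{12}D_xb-f_{22}D_xc+(a-c)\Delta_{13}+2b\Delta_{23}=0,$$ where $D_x,D_t$ are total derivatives (ordinary partial derivatives when $a,b,c$ depend only on $x,t$). The second fundamental form is called universal if $a,b,c$ depend only on $x$ and $t$, independently of the solution $u$. *)

(* Defs.v *)
From Stdlib Require Import Reals.
From Coquelicot Require Import Coquelicot.
Open Scope R_scope.

(** ** Smooth functions of (x,t) *)

Definition pdx (g : R -> R -> R) (x t : R) : R := Derive (fun y => g y t) x.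
Definition pdt (g : R -> R -> R) (x t : R) : R := Derive (fun s => g x s) t.

Fixpoint Ck (n : nat) (U : R * R -> Prop) (g : R -> R -> R) : Prop :=
  (forall x t, U (x, t) -> continuity_2d_pt g x t) /\
  match n with
  | O => True
  | S n' =>
      (forall x t, U (x, t) ->
         ex_derive (fun y => g y t) x /\ ex_derive (fun s => g x s) t) /\
      Ck n' U (pdx g) /\ Ck n' U (pdt g)
  end.

Definition smooth (U : R * R -> Prop) (g : R -> R -> R) : Prop :=
  forall n, Ck n U g.

(** ** Functions of u and its x-derivatives *)

(* [z i] stands for u_i. *)
Definition jet : Type := nat -> R.

Definition jet_of (u : R -> R -> R) (x t : R) : jet :=
  fun i => Derive_n (fun y => u y t) i x.

Definition upd (z : jet) (i : nat) (s : R) : jet :=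
  fun j => if Nat.eqb j i then s else z j.

Definition jet_pd (i : nat) (f : jet -> R) (z : jet) : R :=
  Derive (fun s => f (upd z i s)) (z i).

(* Continuity as a function of u_0, ..., u_k; in particular f does not depend
   on u_i for i > k. *)
Definition jet_continuous (k : nat) (f : jet -> R) : Prop :=
  forall z (eps : posreal), exists delta : posreal, forall z',
    (forall i, (i <= k)%nat -> Rabs (z' i - z i) < delta) ->
    Rabs (f z' - f z) < eps.

Fixpoint jet_Ck (k n : nat) (f : jet -> R) : Prop :=
  jet_continuous k f /\
  match n with
  | O => True
  | S n' => forall i, (i <= k)%nat ->
      (forall z, ex_derive (fun s => f (upd z i s)) (z i)) /\
      jet_Ck k n' (jet_pd i f)
  end.

Definition jet_smooth (k : nat) (f : jet -> R) : Prop :=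
  forall n, jet_Ck k n f.

(** ** 1-forms *)

Record one_form := OneForm { cdx : R -> R -> R; cdt : R -> R -> R }.

(* 2-forms in the plane are given by their coefficient on dx /\ dt. *)
Definition wedge (w w' : one_form) (x t : R) : R :=
  cdx w x t * cdt w' x t - cdx w' x t * cdt w x t.

Definition ext_d (w : one_form) (x t : R) : R :=
  pdx (cdt w) x t - pdt (cdx w) x t.

Definition lin_comb (a b : R -> R -> R) (w w' : one_form) : one_form :=
  OneForm (fun x t => a x t * cdx w x t + b x t * cdx w' x t)
          (fun x t => a x t * cdt w x t + b x t * cdt w' x t).

(* The 1-form f_1(u_0, u_1, ...) dx + f_2(u_0, u_1, ...) dt. *)
Record jet_form := JetForm { f_1 : jet -> R; f_2 : jet -> R }.

Definition pull (w : jet_form) (u : R -> R -> R) : one_form :=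
  OneForm (fun x t => f_1 w (jet_of u x t)) (fun x t => f_2 w (jet_of u x t)).

Definition Delta (w w' : jet_form) (z : jet) : R :=
  f_1 w z * f_2 w' z - f_1 w' z * f_2 w z.

(** ** Equations describing pseudospherical surfaces *)

(* A differential equation, as a condition on u at the point (x,t). *)
Definition equation : Type := (R -> R -> R) -> R -> R -> Prop.

Definition solution (E : equation) (U : R * R -> Prop) (u : R -> R -> R) : Prop :=
  open U /\ smooth U u /\ forall x t, U (x, t) -> E u x t.

Definition pss_solution (E : equation) (w1 w2 : jet_form)
    (U : R * R -> Prop) (u : R -> R -> R) : Prop :=
  solution E U u /\
  forall x t, U (x, t) -> wedge (pull w1 u) (pull w2 u) x t <> 0.

Definition structure_equations (t1 t2 t3 : one_form) (x t : R) : Prop :=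
  ext_d t1 x t = wedge t3 t2 x t /\
  ext_d t2 x t = wedge t1 t3 x t /\
  ext_d t3 x t = wedge t1 t2 x t.

Record describes_pss (E : equation) (w1 w2 w3 : jet_form) : Prop := {
  pss_smooth : exists k,
    jet_smooth k (f_1 w1) /\ jet_smooth k (f_2 w1) /\
    jet_smooth k (f_1 w2) /\ jet_smooth k (f_2 w2) /\
    jet_smooth k (f_1 w3) /\ jet_smooth k (f_2 w3);
  pss_linear : exists mu2 eta2 mu3 eta3 : R, forall z,
    f_1 w2 z = mu2 * f_1 w1 z + eta2 /\ f_1 w3 z = mu3 * f_1 w1 z + eta3;
  (* w1 /\ w2 <> 0 generically: otherwise w1 = w2 = w3 = 0 would be allowed,
     and the conditions on solutions below would be vacuous. *)
  pss_generic : forall z (eps : posreal), exists z',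
    (forall i, Rabs (z' i - z i) < eps) /\ Delta w1 w2 z' <> 0;
  pss_Delta : forall z, Delta w1 w2 z <> 0 ->
    Delta w1 w3 z ^ 2 + Delta w2 w3 z ^ 2 <> 0;
  pss_structure : forall U u, pss_solution E w1 w2 U u ->
    forall x t, U (x, t) ->
      structure_equations (pull w1 u) (pull w2 u) (pull w3 u) x t
}.

(** ** Immersed surfaces in Euclidean 3-space *)

(* A quadratic form A dx^2 + 2 B dx dt + C dt^2 is the triple (A, B, C). *)
Definition qform : Type := (R * R * R)%type.

Definition qplus (q q' : qform) : qform :=
  let '(A, B, C) := q in let '(A', B', C') := q' in (A + A', B + B', C + C').

Definition sym_prod (w w' : one_form) (x t : R) : qform :=
  (cdx w x t * cdx w' x t,
   (cdx w x t * cdt w' x t + cdt w x t * cdx w' x t) / 2,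
   cdt w x t * cdt w' x t).

(* Maps from the plane to E^3, by components. *)
Record map3 := Map3 { c1 : R -> R -> R; c2 : R -> R -> R; c3 : R -> R -> R }.

Definition smooth3 (W : R * R -> Prop) (X : map3) : Prop :=
  smooth W (c1 X) /\ smooth W (c2 X) /\ smooth W (c3 X).

Definition pdx3 (X : map3) : map3 := Map3 (pdx (c1 X)) (pdx (c2 X)) (pdx (c3 X)).
Definition pdt3 (X : map3) : map3 := Map3 (pdt (c1 X)) (pdt (c2 X)) (pdt (c3 X)).

Definition dot (X Y : map3) (x t : R) : R :=
  c1 X x t * c1 Y x t + c2 X x t * c2 Y x t + c3 X x t * c3 Y x t.

Definition independent3 (X Y : map3) (x t : R) : Prop :=
  forall r s : R,
    r * c1 X x t + s * c1 Y x t = 0 -> r * c2 X x t + s * c2 Y x t = 0 ->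
    r * c3 X x t + s * c3 Y x t = 0 -> r = 0 /\ s = 0.

Definition immersion (W : R * R -> Prop) (X : map3) : Prop :=
  smooth3 W X /\ forall x t, W (x, t) -> independent3 (pdx3 X) (pdt3 X) x t.

Definition unit_normal (W : R * R -> Prop) (X N : map3) : Prop :=
  smooth3 W N /\ forall x t, W (x, t) ->
    dot N N x t = 1 /\ dot N (pdx3 X) x t = 0 /\ dot N (pdt3 X) x t = 0.

Definition first_form (X : map3) (x t : R) : qform :=
  (dot (pdx3 X) (pdx3 X) x t, dot (pdx3 X) (pdt3 X) x t,
   dot (pdt3 X) (pdt3 X) x t).

Definition second_form (X N : map3) (x t : R) : qform :=
  (dot (pdx3 (pdx3 X)) N x t, dot (pdt3 (pdx3 X)) N x t,
   dot (pdt3 (pdt3 X)) N x t).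

(* X is an isometric immersion of (W, t1^2 + t2^2) whose second fundamental
   form, for a suitable unit normal, is t1 t13 + t2 t23 with
   t13 = a t1 + b t2 and t23 = b t1 + c t2. *)
Definition isometric_immersion (W : R * R -> Prop) (t1 t2 : one_form)
    (a b c : R -> R -> R) (X : map3) : Prop :=
  immersion W X /\
  exists N, unit_normal W X N /\ forall x t, W (x, t) ->
    first_form X x t = qplus (sym_prod t1 t1 x t) (sym_prod t2 t2 x t) /\
    second_form X N x t =
      qplus (sym_prod t1 (lin_comb a b t1 t2) x t)
            (sym_prod t2 (lin_comb b c t1 t2) x t).

(* a, b, c are chosen before the solution u, which expresses that they do not
   depend on it.  They are only local functions: they may be unable to
   extend to the whole plane, but exist near any prescribed point. *)
Definition universal_second_form (E : equation) (w1 w2 : jet_form) : Prop :=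
  forall x0 t0 : R, exists (V : R * R -> Prop) (a b c : R -> R -> R),
    open V /\ V (x0, t0) /\ smooth V a /\ smooth V b /\ smooth V c /\
    forall U u, pss_solution E w1 w2 U u ->
    forall x t, U (x, t) -> V (x, t) ->
    exists (W : R * R -> Prop) (X : map3),
      open W /\ W (x, t) /\ (forall p, W p -> U p /\ V p) /\
      isometric_immersion W (pull w1 u) (pull w2 u) a b c X.

(** ** The generalized Camassa-Holm equation *)

Definition generalized_CH : equation := fun u x t =>
  let u0 := u x t in
  let u1 := jet_of u x t 1%nat in
  let u2 := jet_of u x t 2%nat in
  let u3 := jet_of u x t 3%nat in
  pdt u x t - pdt (fun y s => jet_of u y s 2%nat) x t =
    u0 ^ 2 * u3 - u0 ^ 2 * u2 - 3 * u0 * u1 ^ 2 - 2 * u0 ^ 2 * u1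
    + 4 * u0 * u1 * u2 + u1 ^ 3.

(* Main.v *)
(** With m = u - u_xx, v = u - u_x and F = u v^2 - u^2 m the equation reads
    m_t = F_x + F, that is (1 + D_x) (v_t - F) = 0 since m = (1 + D_x) v.
    Hence w1 = w3 = m dx + F dt and w2 = dx satisfy the structure equations, and
    e^x w1 = dz is closed.  The metric dx^2 + e^(-2x) dz^2 is that of the
    tractroid with radius s = e^(k-x) and angle theta = z / e^k, defined for x > k:
    (s cos theta, s sin theta, h (x)) with h' = sqrt (1 - s^2).  Its principal
    curvatures - sqrt (1 - s^2) / s and s / sqrt (1 - s^2), in the directions of
    w1 and w2, are functions of x alone; any point (x0, t0) is covered by taking
    k = x0 - 1. *)

Require Import Defs.
From Stdlib Require Import ssreflect Reals Lra Lia FunctionalExtensionality.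
From Coquelicot Require Import Coquelicot.
(* Reals also exports the names c1 and Delta. *)
Import Defs.
Open Scope R_scope.

(** * Slices and neighbourhoods of open sets *)

Lemma open_locally_x (U : R * R -> Prop) x t : open U -> U (x, t) -> locally x (fun y => U (y, t)).
Proof.
  intros HU Hxt. destruct (HU _ Hxt) as [d Hd].
  exists d. intros y Hy. apply Hd. split; [exact Hy | apply ball_center].
Qed.

Lemma open_locally_t (U : R * R -> Prop) x t : open U -> U (x, t) -> locally t (fun s => U (x, s)).
Proof.
  intros HU Hxt. destruct (HU _ Hxt) as [d Hd].
  exists d. intros y Hy. apply Hd. split; [apply ball_center | exact Hy].
Qed.

Lemma open_locally_2d (U : R * R -> Prop) x t : open U -> U (x, t) ->
  locally_2d (fun y s => U (y, s)) x t.
Proof.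
  intros HU Hxt. destruct (HU _ Hxt) as [d Hd].
  exists d. intros y s Hy Hs. apply Hd. split; [exact Hy | exact Hs].
Qed.

(** * Calculus of explicit partial derivatives *)

(** Both derivatives are explicit functions, so the rules below build existence and value together.
    Joint continuity is part of the package because partial derivatives alone do not give it. *)
Definition partials (U : R * R -> Prop) (g gx gt : R -> R -> R) : Prop :=
  forall x t, U (x, t) ->
    continuity_2d_pt g x t /\
    is_derive (fun y => g y t) x (gx x t) /\
    is_derive (fun s => g x s) t (gt x t).

Lemma partials_pdx (U : R * R -> Prop) g gx gt x t :
  partials U g gx gt -> U (x, t) -> pdx g x t = gx x t.
Proof. intros H Hxt. apply is_derive_unique, (H x t Hxt). Qed.

Lemma partials_pdt (U : R * R -> Prop) g gx gt x t :
  partials U g gx gt -> U (x, t) -> pdt g x t = gt x t.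
Proof. intros H Hxt. apply is_derive_unique, (H x t Hxt). Qed.

Lemma pdx_ext_open (U : R * R -> Prop) f g x t : open U ->
  (forall y s, U (y, s) -> f y s = g y s) -> U (x, t) -> pdx f x t = pdx g x t.
Proof.
  intros HU E Hxt. apply Derive_ext_loc.
  refine (filter_imp _ _ _ (open_locally_x U x t HU Hxt)). auto.
Qed.

Lemma pdt_ext_open (U : R * R -> Prop) f g x t : open U ->
  (forall y s, U (y, s) -> f y s = g y s) -> U (x, t) -> pdt f x t = pdt g x t.
Proof.
  intros HU E Hxt. apply Derive_ext_loc.
  refine (filter_imp _ _ _ (open_locally_t U x t HU Hxt)). auto.
Qed.

(** [pdx g] agrees with [gx] only on U, but U is open, so at its points the two have the same
    derivatives. The same holds for the next two lemmas. *)
Lemma partials_pdx_pdx (U : R * R -> Prop) g gx gt gxx gxt x t : open U ->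
  partials U g gx gt -> partials U gx gxx gxt -> U (x, t) ->
  pdx (pdx g) x t = gxx x t.
Proof.
  intros HU H H' Hxt. rewrite <- (partials_pdx U gx gxx gxt x t H' Hxt).
  apply (pdx_ext_open U); auto. intros; now apply (partials_pdx U g gx gt).
Qed.

Lemma partials_pdt_pdx (U : R * R -> Prop) g gx gt gxx gxt x t : open U ->
  partials U g gx gt -> partials U gx gxx gxt -> U (x, t) ->
  pdt (pdx g) x t = gxt x t.
Proof.
  intros HU H H' Hxt. rewrite <- (partials_pdt U gx gxx gxt x t H' Hxt).
  apply (pdt_ext_open U); auto. intros; now apply (partials_pdx U g gx gt).
Qed.

Lemma partials_pdt_pdt (U : R * R -> Prop) g gx gt gtx gtt x t : open U ->
  partials U g gx gt -> partials U gt gtx gtt -> U (x, t) ->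
  pdt (pdt g) x t = gtt x t.
Proof.
  intros HU H H' Hxt. rewrite <- (partials_pdt U gt gtx gtt x t H' Hxt).
  apply (pdt_ext_open U); auto. intros; now apply (partials_pdt U g gx gt).
Qed.

Lemma partials_ext (U : R * R -> Prop) g gx gt gx' gt' : partials U g gx gt ->
  (forall x t, U (x, t) -> gx x t = gx' x t) ->
  (forall x t, U (x, t) -> gt x t = gt' x t) -> partials U g gx' gt'.
Proof.
  intros H Ex Et x t Hxt. rewrite <- Ex, <- Et by assumption. now apply H.
Qed.

Lemma partials_sub (U V : R * R -> Prop) g gx gt :
  (forall p, V p -> U p) -> partials U g gx gt -> partials V g gx gt.
Proof. intros S H x t Hxt. now apply H, S. Qed.

Lemma partials_const (U : R * R -> Prop) c : partials U (fun _ _ => c) (fun _ _ => 0) (fun _ _ => 0).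
Proof.
  intros x t _. split; [apply continuity_2d_pt_const|].
  split; apply: is_derive_const.
Qed.

Lemma partials_plus (U : R * R -> Prop) f fx ft g gx gt :
  partials U f fx ft -> partials U g gx gt ->
  partials U (fun x t => f x t + g x t)
    (fun x t => fx x t + gx x t) (fun x t => ft x t + gt x t).
Proof.
  intros Hf Hg x t Hxt.
  destruct (Hf x t Hxt) as (? & ? & ?), (Hg x t Hxt) as (? & ? & ?).
  split; [now apply continuity_2d_pt_plus|].
  split; now apply: is_derive_plus.
Qed.

Lemma partials_mult (U : R * R -> Prop) f fx ft g gx gt :
  partials U f fx ft -> partials U g gx gt ->
  partials U (fun x t => f x t * g x t)
    (fun x t => fx x t * g x t + f x t * gx x t)
    (fun x t => ft x t * g x t + f x t * gt x t).
Proof.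
  intros Hf Hg x t Hxt.
  destruct (Hf x t Hxt) as (? & ? & ?), (Hg x t Hxt) as (? & ? & ?).
  split; [now apply continuity_2d_pt_mult|].
  split.
  - apply: (is_derive_mult (fun y => f y t) (fun y => g y t)); auto using Rmult_comm.
  - apply: (is_derive_mult (fun s => f x s) (fun s => g x s)); auto using Rmult_comm.
Qed.

Lemma partials_opp (U : R * R -> Prop) g gx gt : partials U g gx gt ->
  partials U (fun x t => - g x t) (fun x t => - gx x t) (fun x t => - gt x t).
Proof.
  intros Hg x t Hxt. destruct (Hg x t Hxt) as (? & ? & ?).
  split; [now apply continuity_2d_pt_opp|].
  split; now apply: is_derive_opp.
Qed.

Lemma partials_comp (U : R * R -> Prop) (phi dphi : R -> R) g gx gt :
  (forall x t, U (x, t) -> is_derive phi (g x t) (dphi (g x t))) ->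
  partials U g gx gt ->
  partials U (fun x t => phi (g x t))
    (fun x t => gx x t * dphi (g x t)) (fun x t => gt x t * dphi (g x t)).
Proof.
  intros Hphi Hg x t Hxt. destruct (Hg x t Hxt) as (? & ? & ?).
  pose proof (Hphi x t Hxt) as D.
  split.
  - apply continuity_1d_2d_pt_comp; auto.
    apply continuity_pt_filterlim, (ex_derive_continuous phi).
    now exists (dphi (g x t)).
  - split.
    + now apply (is_derive_comp phi (fun y => g y t)).
    + now apply (is_derive_comp phi (fun s => g x s)).
Qed.

Lemma partials_fun_x (U : R * R -> Prop) (phi dphi : R -> R) :
  (forall x t, U (x, t) -> is_derive phi x (dphi x)) ->
  partials U (fun x _ => phi x) (fun x _ => dphi x) (fun _ _ => 0).
Proof.
  intros H.
  assert (Hid : partials U (fun x _ => x) (fun _ _ => 1) (fun _ _ => 0)).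
  { intros x t _. split; [apply continuity_2d_pt_id1|].
    split; [apply: is_derive_id | apply: is_derive_const]. }
  apply (partials_ext _ _ _ _ _ _
    (partials_comp U phi dphi (fun x _ => x) _ _ H Hid)); intros; simpl; ring.
Qed.

Lemma partials_fun_t (U : R * R -> Prop) (phi dphi : R -> R) :
  (forall x t, U (x, t) -> is_derive phi t (dphi t)) ->
  partials U (fun _ t => phi t) (fun _ _ => 0) (fun _ t => dphi t).
Proof.
  intros H.
  assert (Hid : partials U (fun _ t => t) (fun _ _ => 0) (fun _ _ => 1)).
  { intros x t _. split; [apply continuity_2d_pt_id2|].
    split; [apply: is_derive_const | apply: is_derive_id]. }
  apply (partials_ext _ _ _ _ _ _
    (partials_comp U phi dphi (fun _ t => t) _ _ H Hid)); intros; simpl; ring.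
Qed.

(** * Closure properties of C^k and smooth functions *)

(** Continuity and derivatives at a point depend only on nearby values; as U is open, [pdx] and
    [pdt] of both functions agree on U again and the induction continues. *)
Lemma Ck_ext n : forall (U : R * R -> Prop) f g, open U ->
  (forall x t, U (x, t) -> f x t = g x t) -> Ck n U f -> Ck n U g.
Proof.
  induction n as [|n IH]; intros U f g HU E [Hc Hd]; split.
  1, 3: intros x t Hxt; apply (continuity_2d_pt_ext_loc f); auto;
    destruct (open_locally_2d U x t HU Hxt) as [d D]; exists d; auto.
  - exact I.
  - destruct Hd as (Hd & Hx & Ht). split; [|split].
    + intros x t Hxt. destruct (Hd x t Hxt) as [D1 D2]. split.
      * apply: (ex_derive_ext_loc _ _ _ _ D1).
        refine (filter_imp _ _ _ (open_locally_x U x t HU Hxt)). auto.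
      * apply: (ex_derive_ext_loc _ _ _ _ D2).
        refine (filter_imp _ _ _ (open_locally_t U x t HU Hxt)). auto.
    + apply (IH U (pdx f)); auto. intros; now apply (pdx_ext_open U).
    + apply (IH U (pdt f)); auto. intros; now apply (pdt_ext_open U).
Qed.

Lemma Ck_continuous n (U : R * R -> Prop) g x t : Ck n U g -> U (x, t) -> continuity_2d_pt g x t.
Proof. destruct n; intros [Hc _]; auto. Qed.

Lemma Ck_partials n (U : R * R -> Prop) g : Ck (S n) U g -> partials U g (pdx g) (pdt g).
Proof.
  intros (Hc & Hd & _) x t Hxt. destruct (Hd x t Hxt).
  split; [|split]; auto; now apply Derive_correct.
Qed.

(** Introduction rule used in all the inductions on the order: [Ck] speaks of [pdx] and [pdt], and
    on U these may be replaced by the explicit partials. *)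
Lemma Ck_step n (U : R * R -> Prop) g gx gt : open U ->
  partials U g gx gt -> Ck n U gx -> Ck n U gt -> Ck (S n) U g.
Proof.
  intros HU H Hx Ht. split; [|split; [|split]].
  - intros x t Hxt. now apply H.
  - intros x t Hxt. destruct (H x t Hxt) as (_ & ? & ?).
    split; eexists; eassumption.
  - apply (Ck_ext n U gx); auto. intros; now rewrite (partials_pdx U g gx gt).
  - apply (Ck_ext n U gt); auto. intros; now rewrite (partials_pdt U g gx gt).
Qed.

Lemma Ck_pred n : forall (U : R * R -> Prop) g, Ck (S n) U g -> Ck n U g.
Proof.
  induction n as [|n IH]; intros U g (Hc & Hd & Hx & Ht); split; auto.
Qed.

Lemma Ck_sub n : forall (U V : R * R -> Prop) g,
  (forall p, V p -> U p) -> Ck n U g -> Ck n V g.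
Proof.
  induction n as [|n IH]; intros U V g S [Hc Hd]; split; auto.
  destruct Hd as (Hd & Hx & Ht). split; [|split]; auto; now apply (IH U).
Qed.

Lemma Ck_const n : forall (U : R * R -> Prop) c, open U -> Ck n U (fun _ _ => c).
Proof.
  induction n as [|n IH]; intros U c HU.
  - split; auto. intros; apply continuity_2d_pt_const.
  - apply: Ck_step; auto using partials_const.
Qed.

Lemma Ck_plus n : forall (U : R * R -> Prop) f g, open U ->
  Ck n U f -> Ck n U g -> Ck n U (fun x t => f x t + g x t).
Proof.
  induction n as [|n IH]; intros U f g HU Hf Hg.
  - destruct Hf, Hg. split; auto. intros; apply continuity_2d_pt_plus; auto.
  - apply: Ck_step; auto.
    + apply partials_plus; eapply Ck_partials; eassumption.
    + apply IH; auto; [apply Hf | apply Hg].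
    + apply IH; auto; [apply Hf | apply Hg].
Qed.

Lemma Ck_mult n : forall (U : R * R -> Prop) f g, open U ->
  Ck n U f -> Ck n U g -> Ck n U (fun x t => f x t * g x t).
Proof.
  induction n as [|n IH]; intros U f g HU Hf Hg.
  - destruct Hf, Hg. split; auto. intros; apply continuity_2d_pt_mult; auto.
  - pose proof (Ck_pred n U f Hf). pose proof (Ck_pred n U g Hg).
    apply: Ck_step; auto.
    + apply partials_mult; eapply Ck_partials; eassumption.
    + apply Ck_plus; auto; apply IH; auto; [apply Hf | apply Hg].
    + apply Ck_plus; auto; apply IH; auto; [apply Hf | apply Hg].
Qed.

Lemma Ck_opp n (U : R * R -> Prop) g : open U -> Ck n U g -> Ck n U (fun x t => - g x t).
Proof.
  intros HU Hg. apply (Ck_ext n U (fun x t => -1 * g x t)); auto.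
  - intros; ring.
  - apply Ck_mult; auto using Ck_const.
Qed.

Lemma smooth_partials (U : R * R -> Prop) g : smooth U g -> partials U g (pdx g) (pdt g).
Proof. intros H. exact (Ck_partials 0 U g (H 1%nat)). Qed.

Lemma smooth_pdx (U : R * R -> Prop) g : smooth U g -> smooth U (pdx g).
Proof. intros H n. apply (H (S n)). Qed.

Lemma smooth_pdt (U : R * R -> Prop) g : smooth U g -> smooth U (pdt g).
Proof. intros H n. apply (H (S n)). Qed.

Lemma smooth_sub (U V : R * R -> Prop) g :
  (forall p, V p -> U p) -> smooth U g -> smooth V g.
Proof. intros S H n. now apply (Ck_sub n U). Qed.

Lemma smooth_of_partials (U : R * R -> Prop) g gx gt : open U ->
  partials U g gx gt -> smooth U gx -> smooth U gt -> smooth U g.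
Proof. intros HU H Hx Ht n. apply Ck_pred. now apply (Ck_step n U g gx gt). Qed.

Lemma smooth_const (U : R * R -> Prop) c : open U -> smooth U (fun _ _ => c).
Proof. intros HU n. now apply Ck_const. Qed.

Lemma smooth_plus (U : R * R -> Prop) f g : open U ->
  smooth U f -> smooth U g -> smooth U (fun x t => f x t + g x t).
Proof. intros HU Hf Hg n. now apply Ck_plus. Qed.

Lemma smooth_mult (U : R * R -> Prop) f g : open U ->
  smooth U f -> smooth U g -> smooth U (fun x t => f x t * g x t).
Proof. intros HU Hf Hg n. now apply Ck_mult. Qed.

Lemma smooth_opp (U : R * R -> Prop) g : open U -> smooth U g -> smooth U (fun x t => - g x t).
Proof. intros HU Hg n. now apply Ck_opp. Qed.

Lemma smooth_pdt_pdx (U : R * R -> Prop) g x t : open U -> smooth U g -> U (x, t) ->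
  pdt (pdx g) x t = pdx (pdt g) x t.
Proof.
  intros HU Hg Hxt.
  pose proof (smooth_partials U g Hg) as P.
  pose proof (smooth_partials U _ (smooth_pdx U g Hg)) as Px.
  pose proof (smooth_partials U _ (smooth_pdt U g Hg)) as Pt.
  symmetry. apply (Schwarz g x t).
  - destruct (open_locally_2d U x t HU Hxt) as [d D]. exists d.
    intros y s Hy Hs. specialize (D y s Hy Hs).
    destruct (P y s D) as (_ & ? & ?), (Px y s D) as (_ & _ & ?),
      (Pt y s D) as (_ & ? & _).
    repeat split; eexists; eassumption.
  - apply (Ck_continuous 0 U (pdx (pdt g))); auto.
    exact (smooth_pdx _ _ (smooth_pdt _ _ Hg) 0%nat).
  - apply (Ck_continuous 0 U (pdt (pdx g))); auto.
    exact (smooth_pdt _ _ (smooth_pdx _ _ Hg) 0%nat).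
Qed.

(** Differentiating either function produces the other one, so the induction on the order carries
    both at once. *)
Lemma smooth_cos_sin (U : R * R -> Prop) g : open U -> smooth U g ->
  smooth U (fun x t => cos (g x t)) /\ smooth U (fun x t => sin (g x t)).
Proof.
  intros HU Hg. pose proof (smooth_partials U g Hg) as P.
  pose proof (partials_comp U cos (fun y => - sin y) g _ _
    (fun x t _ => is_derive_cos (g x t)) P) as Pc.
  pose proof (partials_comp U sin cos g _ _
    (fun x t _ => is_derive_sin (g x t)) P) as Ps.
  assert (H : forall n, Ck n U (fun x t => cos (g x t)) /\
                        Ck n U (fun x t => sin (g x t))).
  { induction n as [|n [IHc IHs]].
    - split; split; auto; intros; [now apply Pc | now apply Ps].
    - pose proof (smooth_pdx U g Hg n). pose proof (smooth_pdt U g Hg n).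
      split; apply: Ck_step; eauto; apply Ck_mult; auto; now apply Ck_opp. }
  split; intros n; apply H.
Qed.

Lemma smooth_exp (U : R * R -> Prop) g : open U -> smooth U g -> smooth U (fun x t => exp (g x t)).
Proof.
  intros HU Hg. pose proof (smooth_partials U g Hg) as P.
  pose proof (partials_comp U exp exp g _ _
    (fun x t _ => is_derive_exp (g x t)) P) as Pe.
  intros n. induction n as [|n IH].
  - split; auto. intros; now apply Pe.
  - apply: Ck_step; eauto; apply Ck_mult; auto;
      [apply (smooth_pdx U g Hg) | apply (smooth_pdt U g Hg)].
Qed.

Lemma smooth_inv (U : R * R -> Prop) g : open U -> (forall x t, U (x, t) -> g x t <> 0) ->
  smooth U g -> smooth U (fun x t => / g x t).
Proof.
  intros HU H0 Hg. pose proof (smooth_partials U g Hg) as P.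
  (* The derivative is written as a product of factors [/ g], so that the induction hypothesis for
     [/ g] applies to it. *)
  assert (Pi : partials U (fun x t => / g x t)
    (fun x t => pdx g x t * - (/ g x t * / g x t))
    (fun x t => pdt g x t * - (/ g x t * / g x t))).
  { apply (partials_comp U Rinv (fun y => - (/ y * / y))); auto.
    intros x t Hxt. specialize (H0 x t Hxt).
    auto_derive; auto. field; auto. }
  intros n. induction n as [|n IH].
  - split; auto. intros; now apply Pi.
  - apply: Ck_step; eauto; apply Ck_mult; auto using Ck_opp, Ck_mult;
      [apply (smooth_pdx U g Hg) | apply (smooth_pdt U g Hg)].
Qed.

Lemma smooth_sqrt (U : R * R -> Prop) g : open U -> (forall x t, U (x, t) -> 0 < g x t) ->
  smooth U g -> smooth U (fun x t => sqrt (g x t)).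
Proof.
  intros HU H0 Hg. pose proof (smooth_partials U g Hg) as P.
  (* The derivative of the root is taken as sqrt g / (2 g) instead of 1 / (2 sqrt g): it then
     involves only the root itself and the smooth function [/ g]. *)
  assert (Ps : partials U (fun x t => sqrt (g x t))
    (fun x t => pdx g x t * (/ 2 * (sqrt (g x t) * / g x t)))
    (fun x t => pdt g x t * (/ 2 * (sqrt (g x t) * / g x t)))).
  { apply (partials_comp U sqrt (fun y => / 2 * (sqrt y * / y))); auto.
    intros x t Hxt. specialize (H0 x t Hxt).
    auto_derive; auto.
    pose proof (sqrt_lt_R0 _ H0). rewrite <- (sqrt_sqrt (g x t)) at 3 by lra.
    field. lra. }
  assert (Hi : smooth U (fun x t => / g x t)).
  { apply smooth_inv; auto. intros x t Hxt. specialize (H0 x t Hxt). lra. }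
  intros n. specialize (Hi n). induction n as [|n IH].
  - split; auto. intros; now apply Ps.
  - specialize (IH (Ck_pred _ _ _ Hi)).
    apply: Ck_step; eauto;
    (apply Ck_mult; auto;
      [apply (smooth_pdx U g Hg) || apply (smooth_pdt U g Hg)
      | apply Ck_mult; auto using Ck_const;
        apply Ck_mult; auto using Ck_pred]).
Qed.

Lemma smooth_fun_x (U : R * R -> Prop) : open U -> smooth U (fun x _ => x).
Proof.
  intros HU. apply (smooth_of_partials U _ (fun _ _ => 1) (fun _ _ => 0));
    auto using smooth_const.
  apply (partials_fun_x U (fun x => x) (fun _ => 1)). intros; apply: is_derive_id.
Qed.

(** * Boxes and integration in t *)

(** A square is convenient because the path from a point of it, first along x to the line x = x1 and
    then along t to (x1, t1), stays inside. *)
Definition box (x1 t1 d : R) (p : R * R) : Prop :=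
  (x1 - d < fst p < x1 + d) /\ (t1 - d < snd p < t1 + d).

Lemma open_box x1 t1 d : open (box x1 t1 d).
Proof.
  repeat apply: open_and.
  - apply (open_comp (fun p : R * R => fst p) (fun u => x1 - d < u)); [|apply open_gt].
    intros p _; apply: continuous_fst.
  - apply (open_comp (fun p : R * R => fst p) (fun u => u < x1 + d)); [|apply open_lt].
    intros p _; apply: continuous_fst.
  - apply (open_comp (fun p : R * R => snd p) (fun u => t1 - d < u)); [|apply open_gt].
    intros p _; apply: continuous_snd.
  - apply (open_comp (fun p : R * R => snd p) (fun u => u < t1 + d)); [|apply open_lt].
    intros p _; apply: continuous_snd.
Qed.

Lemma open_contains_box (U : R * R -> Prop) x1 t1 : open U -> U (x1, t1) ->
  exists d, 0 < d /\ forall p, box x1 t1 d p -> U p.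
Proof.
  intros HU H. destruct (HU _ H) as [d Hd]. exists d. split; [apply cond_pos|].
  intros [y s] [Hy Hs]. simpl in Hy, Hs. apply Hd. split.
  - change (Rabs (y - x1) < d). apply Rabs_def1; lra.
  - change (Rabs (s - t1) < d). apply Rabs_def1; lra.
Qed.

Lemma constant_in_x x1 t1 d G Gt :
  partials (box x1 t1 d) G (fun _ _ => 0) Gt ->
  forall x t, box x1 t1 d (x, t) -> G x t = G x1 t.
Proof.
  intros HG x t [Hx Ht]. simpl in Hx, Ht.
  assert (D : forall y, x1 - d < y < x1 + d -> is_derive (fun y => G y t) y zero).
  { intros y Hy. apply (HG y t). now split. }
  destruct (Rtotal_order x x1) as [L | [-> | L]]; auto.
  - apply (eq_is_derive (fun y => G y t)); auto. intros; apply D; lra.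
  - symmetry. apply (eq_is_derive (fun y => G y t)); auto. intros; apply D; lra.
Qed.

(** On the box G equals its restriction to the line x = x1, and the integral of that restriction
    from t1 is a primitive in t. Differentiability in t makes the integrand continuous. *)
Lemma t_primitive x1 t1 d G Gt : 0 < d ->
  partials (box x1 t1 d) G (fun _ _ => 0) Gt ->
  exists g, partials (box x1 t1 d) g (fun _ _ => 0) G.
Proof.
  intros Hd HG. exists (fun _ t => RInt (G x1) t1 t).
  apply (partials_ext _ _ (fun _ _ => 0) (fun _ t => G x1 t)); auto.
  2: { intros x t Hxt. symmetry. now apply (constant_in_x x1 t1 d G Gt). }
  apply (partials_fun_t _ (RInt (G x1) t1) (G x1)).
  intros x t [_ Ht]. simpl in Ht.
  assert (C : forall s, t1 - d < s < t1 + d -> continuous (G x1) s).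
  { intros s Hs. apply (ex_derive_continuous (G x1)). exists (Gt x1 s).
    apply (HG x1 s). split; simpl; lra. }
  apply: is_derive_RInt; [|now apply C].
  apply: (filter_imp (fun s => t1 - d < s < t1 + d)).
  - intros s Hs. apply: RInt_correct. apply ex_RInt_continuous.
    intros r Hr. apply C. unfold Rmin, Rmax in Hr. destruct (Rle_dec t1 s); lra.
  - apply (open_and _ _ (open_gt (t1 - d)) (open_lt (t1 + d))). exact Ht.
Qed.

(** * Polynomials in the jet variables *)

(** The coefficients of the 1-forms are polynomials in u_0, u_1, u_2. This class is closed under
    partial derivatives, which gives [jet_smooth], and structural induction gives smoothness in (x,
    t) along a smooth u. *)
Inductive jet_poly (k : nat) : (jet -> R) -> Prop :=
| jet_poly_const c : jet_poly k (fun _ => c)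
| jet_poly_var i : (i <= k)%nat -> jet_poly k (fun z => z i)
| jet_poly_plus f g : jet_poly k f -> jet_poly k g -> jet_poly k (fun z => f z + g z)
| jet_poly_mult f g : jet_poly k f -> jet_poly k g -> jet_poly k (fun z => f z * g z).

Lemma jet_poly_minus k f g :
  jet_poly k f -> jet_poly k g -> jet_poly k (fun z => f z - g z).
Proof.
  intros Hf Hg.
  replace (fun z => f z - g z) with (fun z => f z + -1 * g z).
  - apply jet_poly_plus; auto. apply jet_poly_mult; auto. apply jet_poly_const.
  - extensionality z. ring.
Qed.

Lemma jet_continuous_comp2 k (op : R -> R -> R) f g :
  (forall x y, continuity_2d_pt op x y) ->
  jet_continuous k f -> jet_continuous k g ->
  jet_continuous k (fun z => op (f z) (g z)).
Proof.
  intros Hop Hf Hg z eps.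
  destruct (Hop (f z) (g z) eps) as [d Hd].
  destruct (Hf z d) as [d1 H1], (Hg z d) as [d2 H2].
  exists (mkposreal _ (Rmin_stable_in_posreal d1 d2)). intros z' Hz. simpl in Hz.
  apply Hd; [apply H1 | apply H2]; intros i Hi; specialize (Hz i Hi);
    [pose proof (Rmin_l d1 d2) | pose proof (Rmin_r d1 d2)]; lra.
Qed.

Lemma jet_poly_continuous k f : jet_poly k f -> jet_continuous k f.
Proof.
  induction 1 as [c | i Hi | f g Hf IHf Hg IHg | f g Hf IHf Hg IHg].
  - intros z eps. exists eps. intros _ _. rewrite Rminus_diag Rabs_R0. apply cond_pos.
  - intros z eps. exists eps. intros z' Hz. now apply Hz.
  - apply (jet_continuous_comp2 k Rplus); auto. intros x y.
    apply continuity_2d_pt_plus; [apply continuity_2d_pt_id1 | apply continuity_2d_pt_id2].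
  - apply (jet_continuous_comp2 k Rmult); auto. intros x y.
    apply continuity_2d_pt_mult; [apply continuity_2d_pt_id1 | apply continuity_2d_pt_id2].
Qed.

Lemma upd_same z i : upd z i (z i) = z.
Proof.
  extensionality j. unfold upd. destruct (Nat.eqb_spec j i) as [-> |]; auto.
Qed.

Lemma jet_poly_derive k f i : jet_poly k f ->
  exists f', jet_poly k f' /\
    forall z, is_derive (fun s => f (upd z i s)) (z i) (f' z).
Proof.
  induction 1 as [c | j Hj | f g Hf [f' [Pf Df]] Hg [g' [Pg Dg]]
                 | f g Hf [f' [Pf Df]] Hg [g' [Pg Dg]]].
  - exists (fun _ => 0). split; [apply jet_poly_const|].
    intros z. apply: is_derive_const.
  (* The derivative of u_j with respect to u_i is the Kronecker delta, a constant polynomial. *)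
  - exists (fun _ => if Nat.eqb j i then 1 else 0). split; [apply jet_poly_const|].
    intros z. unfold upd. destruct (Nat.eqb j i);
      [apply: is_derive_id | apply: is_derive_const].
  - exists (fun z => f' z + g' z). split; [now apply jet_poly_plus|].
    intros z. apply: is_derive_plus; auto.
  - exists (fun z => f' z * g z + f z * g' z). split.
    + apply jet_poly_plus; now apply jet_poly_mult.
    + intros z.
      pose proof (is_derive_mult (fun s => f (upd z i s)) (fun s => g (upd z i s))
        (z i) (f' z) (g' z) (Df z) (Dg z) Rmult_comm) as D.
      simpl in D. rewrite upd_same in D. exact D.
Qed.

Lemma jet_poly_smooth k f : jet_poly k f -> jet_smooth k f.
Proof.
  intros Hf n. revert f Hf.
  induction n as [|n IH]; intros f Hf; (split; [now apply jet_poly_continuous|]); auto.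
  intros i _. destruct (jet_poly_derive k f i Hf) as [f' [Pf Df]]. split.
  - intros z. now exists (f' z).
  - replace (jet_pd i f) with f'; auto.
    extensionality z. symmetry. apply is_derive_unique, Df.
Qed.

(** [Derive_n] of order i + 1 is by definition the [pdx] of the one of order i. *)
Lemma smooth_jet_of (U : R * R -> Prop) u i :
  smooth U u -> smooth U (fun x t => jet_of u x t i).
Proof.
  intros Hu. induction i as [|i IH]; [exact Hu|]. exact (smooth_pdx U _ IH).
Qed.

Lemma smooth_jet_poly (U : R * R -> Prop) u k f : open U -> jet_poly k f ->
  smooth U u -> smooth U (fun x t => f (jet_of u x t)).
Proof.
  intros HU Hf Hu. induction Hf; auto using smooth_const, smooth_jet_of.
  - now apply smooth_plus.
  - now apply smooth_mult.
Qed.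

(** * The equation as a balance law, and its 1-forms *)

Definition momentum (z : jet) : R := z 0%nat - z 2%nat.

Definition flux (z : jet) : R :=
  z 0%nat * ((z 0%nat - z 1%nat) * (z 0%nat - z 1%nat))
  - z 0%nat * z 0%nat * (z 0%nat - z 2%nat).

Definition ch_form1 : jet_form := JetForm momentum flux.
Definition ch_form2 : jet_form := JetForm (fun _ => 1) (fun _ => 0).

Lemma momentum_poly : jet_poly 2 momentum.
Proof. apply jet_poly_minus; apply jet_poly_var; lia. Qed.

Lemma flux_poly : jet_poly 2 flux.
Proof.
  unfold flux.
  repeat first [ apply (jet_poly_minus 2 (fun z => z _ * _) (fun z => z _ * z _ * _))
    | apply (jet_poly_minus 2 (fun z => z _) (fun z => z _))
    | apply jet_poly_mult | apply jet_poly_var; lia ].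
Qed.

(** Expanded, F = u^2 u_xx - 2 u^2 u_x + u u_x^2, and F_x + F is the right-hand side of the
    equation, whose left-hand side is m_t. *)
Lemma generalized_CH_balance U u x t : solution generalized_CH U u -> U (x, t) ->
  pdt (fun y s => momentum (jet_of u y s)) x t =
  pdx (fun y s => flux (jet_of u y s)) x t + flux (jet_of u x t).
Proof.
  intros (HU & Hu & He) Hxt.
  pose proof (smooth_partials U u Hu) as P0.
  pose proof (smooth_pdx U u Hu) as Hu1.
  pose proof (smooth_partials U _ Hu1) as P1.
  pose proof (smooth_pdx U _ Hu1) as Hu2.
  pose proof (smooth_partials U _ Hu2) as P2.
  pose proof (partials_plus _ _ _ _ _ _ _ P0 (partials_opp _ _ _ _ P1)) as Pv.
  pose proof (partials_plus _ _ _ _ _ _ _ P0 (partials_opp _ _ _ _ P2)) as Pm.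
  pose proof (partials_plus _ _ _ _ _ _ _
    (partials_mult _ _ _ _ _ _ _ P0 (partials_mult _ _ _ _ _ _ _ Pv Pv))
    (partials_opp _ _ _ _ (partials_mult _ _ _ _ _ _ _
      (partials_mult _ _ _ _ _ _ _ P0 P0) Pm))) as PF.
  specialize (He x t Hxt). unfold generalized_CH in He. cbv zeta in He.
  rewrite (partials_pdt U (fun y s => momentum (jet_of u y s)) _ _ x t Pm Hxt).
  rewrite (partials_pdx U (fun y s => flux (jet_of u y s)) _ _ x t PF Hxt).
  unfold flux.
  (* These conversions hold by definition; they express the equation and the computed derivatives in
     the same iterated [pdx]. *)
  change (fun y s => jet_of u y s 2%nat) with (pdx (pdx u)) in He.
  change (jet_of u x t 3%nat) with (pdx (pdx (pdx u)) x t) in He.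
  change (jet_of u x t 2%nat) with (pdx (pdx u) x t) in *.
  change (jet_of u x t 1%nat) with (pdx u x t) in *.
  change (jet_of u x t 0%nat) with (u x t) in *.
  cbv beta in *. nra.
Qed.

(** [flux] is affine in u_2 with slope u_0^2. A small change makes u_0 nonzero, and a further one of
    u_2 then moves [flux] away from 0. Since Delta_12 = - flux, this is the genericity of w1 and
    w2. *)
Lemma flux_nonzero_dense z (eps : posreal) :
  exists z', (forall i, Rabs (z' i - z i) < eps) /\ flux z' <> 0.
Proof.
  pose proof (cond_pos eps) as He.
  assert (A : forall r, exists r', Rabs (r' - r) < eps /\ r' <> 0).
  { intros r. destruct (Req_dec r 0) as [-> | Hr].
    - exists (eps / 2). split; [rewrite Rabs_pos_eq; lra | lra].
    - exists r. split; auto. rewrite Rminus_diag Rabs_R0. lra. }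
  destruct (A (z 0%nat)) as [r [Hr Hr0]].
  set (y := upd z 0 r).
  assert (Hy : forall i, Rabs (y i - z i) < eps).
  { intros i. unfold y, upd. destruct (Nat.eqb_spec i 0) as [-> |]; auto.
    rewrite Rminus_diag Rabs_R0. lra. }
  destruct (Req_dec (flux y) 0) as [H0 |]; [|now exists y].
  exists (upd y 2 (z 2%nat + eps / 2)). split.
  - intros i. unfold upd at 1. destruct (Nat.eqb_spec i 2) as [-> |]; auto.
    rewrite Rabs_pos_eq; lra.
  - unfold flux, y, upd in *. simpl in *. intros H1.
    (* Subtracting the two vanishing values of [flux] leaves the slope r^2 times the increment of
       u_2. *)
    assert (E : r * r * (eps / 2) = 0) by lra.
    apply Rmult_integral in E. destruct E as [E | E]; [|lra].
    apply Rmult_integral in E. tauto.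
Qed.

Lemma generalized_CH_describes_pss :
  describes_pss generalized_CH ch_form1 ch_form2 ch_form1.
Proof.
  split.
  - exists 2%nat. repeat split; apply jet_poly_smooth; simpl;
      auto using momentum_poly, flux_poly, jet_poly_const.
  - exists 0, 1, 1, 0. intros z. simpl. split; ring.
  - intros z eps. destruct (flux_nonzero_dense z eps) as [z' [Hz Hf]].
    exists z'. split; auto. unfold Delta. cbn [ch_form1 ch_form2 f_1 f_2]. intros E; apply Hf; lra.
  - intros z. unfold Delta. cbn [ch_form1 ch_form2 f_1 f_2]. intros H.
    assert (F0 : flux z <> 0) by (intros F0; apply H; rewrite F0; ring).
    (* Here Delta_13 = 0 and Delta_23 = flux. *)
    apply Rgt_not_eq.
    replace (_ + _) with (flux z ^ 2) by ring. now apply pow2_gt_0.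
  - intros U u [Hs _] x t Hxt.
    pose proof (generalized_CH_balance U u x t Hs Hxt) as B.
    unfold structure_equations, ext_d, wedge.
    cbn [pull cdx cdt ch_form1 ch_form2 f_1 f_2].
    (* The first and third equations both read F_x - m_t = - F, the balance law. What remains is
       d(dx) = w1 /\ w1, where both sides vanish. *)
    repeat split; try lra.
    unfold pdx, pdt. rewrite !Derive_const. ring.
Qed.

(** * The profile curve of the tractroid *)

(** The curve ([radius], [height]) is the tractrix, for x > k parametrized by arc length: radius' =
    - radius, height' = slope and radius^2 + slope^2 = 1. Its cusp is at x = k, where [radius] is 1
    and [slope] is 0. *)
Definition radius (k x : R) : R := exp (k - x).
Definition slope (k x : R) : R := sqrt (1 - radius k x * radius k x).
Definition height (k x : R) : R := RInt (slope k) k x.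

Lemma radius_pos k x : 0 < radius k x.
Proof. apply exp_pos. Qed.

Lemma radius_lt_1 k x : k < x -> 0 < 1 - radius k x * radius k x.
Proof.
  intros H. pose proof (radius_pos k x).
  assert (radius k x < 1) by (rewrite <- exp_0; apply exp_increasing; lra).
  nra.
Qed.

Lemma slope_pos k x : k < x -> 0 < slope k x.
Proof. intros H. apply sqrt_lt_R0. now apply radius_lt_1. Qed.

Lemma slope_sqr k x : k < x -> slope k x * slope k x = 1 - radius k x * radius k x.
Proof. intros H. apply sqrt_sqrt. pose proof (radius_lt_1 k x H). lra. Qed.

Lemma is_derive_radius k x : is_derive (radius k) x (- radius k x).
Proof. unfold radius. auto_derive; auto. unfold Rminus. ring. Qed.

Lemma is_derive_inv_radius k x :
  is_derive (fun y => / radius k y) x (/ radius k x).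
Proof.
  pose proof (radius_pos k x). unfold radius, Rminus in *. auto_derive; [lra|]. field. lra.
Qed.

Lemma is_derive_slope k x : k < x ->
  is_derive (slope k) x (radius k x * radius k x / slope k x).
Proof.
  intros H. pose proof (radius_lt_1 k x H) as H1. pose proof (slope_pos k x H) as H2.
  unfold slope, radius, Rminus in *. auto_derive; auto. field. lra.
Qed.

(** This holds on both sides of k: [sqrt] is 0 on negative numbers and continuous everywhere, so
    [slope] is continuous on the whole line and the fundamental theorem of calculus applies. *)
Lemma is_derive_height k x : is_derive (height k) x (slope k x).
Proof.
  assert (C : forall y, continuous (slope k) y).
  { intros y. apply (continuous_comp (fun y => 1 - radius k y * radius k y) sqrt);
      [|apply continuous_sqrt].
    apply: ex_derive_continuous. unfold radius. auto_derive. auto. }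
  apply: is_derive_RInt; auto.
  apply filter_forall. intros y. apply: RInt_correct. apply ex_RInt_continuous. auto.
Qed.

Lemma smooth_radius (U : R * R -> Prop) k : open U -> smooth U (fun x _ => radius k x).
Proof.
  intros HU. apply (smooth_exp U (fun x _ => k + - x)); auto.
  apply smooth_plus; auto using smooth_const, smooth_opp, smooth_fun_x.
Qed.

Lemma smooth_slope (U : R * R -> Prop) k : open U ->
  (forall x t, U (x, t) -> k < x) -> smooth U (fun x _ => slope k x).
Proof.
  intros HU Hk. apply (smooth_sqrt U (fun x _ => 1 + - (radius k x * radius k x))); auto.
  - intros x t Hxt. apply radius_lt_1; eauto.
  - apply smooth_plus; auto using smooth_const.
    apply smooth_opp; auto. apply smooth_mult; auto using smooth_radius.
Qed.

Lemma smooth_height (U : R * R -> Prop) k : open U ->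
  (forall x t, U (x, t) -> k < x) -> smooth U (fun x _ => height k x).
Proof.
  intros HU Hk.
  apply (smooth_of_partials U _ (fun x _ => slope k x) (fun _ _ => 0));
    auto using smooth_slope, smooth_const.
  apply (partials_fun_x U (height k)). intros; apply is_derive_height.
Qed.

(** * The rotation angle *)

(* [theta] is v / radius plus a function of t, because (1 + D_x) (F - v_t) = 0
   says that (F - v_t) / radius does not depend on x. *)
Lemma generalized_CH_angle U u k x1 t1 : solution generalized_CH U u -> U (x1, t1) ->
  exists d theta, 0 < d /\ (forall p, box x1 t1 d p -> U p) /\
    partials (box x1 t1 d) theta
      (fun x t => momentum (jet_of u x t) / radius k x)
      (fun x t => flux (jet_of u x t) / radius k x).
Proof.
  intros HS H1. pose proof HS as (HU & Hu & _).
  destruct (open_contains_box U x1 t1 HU H1) as [d [Hd Hbox]].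
  pose proof (open_box x1 t1 d) as HB. set (B := box x1 t1 d) in *.
  pose proof (smooth_partials U u Hu) as P0.
  pose proof (smooth_pdx U u Hu) as Hu1.
  pose proof (smooth_partials U _ Hu1) as P1.
  pose proof (smooth_partials U _ (smooth_pdt U u Hu)) as Pt.
  pose proof (smooth_partials U _ (smooth_pdt U _ Hu1)) as P1t.
  pose proof (smooth_partials U _ (smooth_pdx U _ Hu1)) as P2.
  pose proof (partials_fun_x U _ _ (fun x t _ => is_derive_inv_radius k x)) as Pr.
  pose proof (partials_plus _ _ _ _ _ _ _ P0 (partials_opp _ _ _ _ P1)) as Pv.
  (* Since 1 / radius is its own derivative, the x-derivative of v / radius is (v_x + v) / radius =
     m / radius. *)
  pose proof (partials_mult _ _ _ _ _ _ _ Pv Pr) as PR.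
  pose proof (partials_plus _ _ _ _ _ _ _ Pt (partials_opp _ _ _ _ P1t)) as Pvt.
  assert (PF : partials U (fun x t => flux (jet_of u x t))
     (pdx (fun x t => flux (jet_of u x t))) (pdt (fun x t => flux (jet_of u x t)))).
  { apply smooth_partials, (smooth_jet_poly U u 2); auto using flux_poly. }
  pose proof (partials_mult _ _ _ _ _ _ _
    (partials_plus _ _ _ _ _ _ _ PF (partials_opp _ _ _ _ Pvt)) Pr) as PG.
  apply (partials_sub U B _ _ _ Hbox) in PG.
  eapply (partials_ext _ _ _ _ (fun _ _ => 0)) in PG; cycle 1.
  { intros x t Hxt. apply Hbox in Hxt. cbv beta.
    pose proof (generalized_CH_balance U u x t HS Hxt) as Bal.
    (* Commuting the mixed derivatives turns v_t + (v_t)_x into m_t, which the balance law cancels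
       against F_x + F. *)
    pose proof (smooth_pdt_pdx U u x t HU Hu Hxt) as E1.
    pose proof (smooth_pdt_pdx U _ x t HU Hu1 Hxt) as E2.
    rewrite (partials_pdt U (fun y s => momentum (jet_of u y s)) _ _ x t
      (partials_plus _ _ _ _ _ _ _ P0 (partials_opp _ _ _ _ P2)) Hxt) in Bal.
    cbv beta in Bal. rewrite <- E1, <- E2.
    transitivity ((pdx (fun y s => flux (jet_of u y s)) x t + flux (jet_of u x t)
      - (pdt u x t - pdt (pdx (pdx u)) x t)) * / radius k x); [ring|].
    rewrite <- Bal. ring. }
  { intros; reflexivity. }
  destruct (t_primitive x1 t1 d _ _ Hd PG) as [g Pg].
  exists d. eexists. split; [exact Hd | split; [exact Hbox|]].
  apply (partials_ext _ _ _ _ _ _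
    (partials_plus _ _ _ _ _ _ _ (partials_sub U B _ _ _ Hbox PR) Pg)).
  - intros x t _. unfold momentum.
    change (jet_of u x t 2%nat) with (pdx (pdx u) x t).
    change (jet_of u x t 0%nat) with (u x t).
    unfold Rdiv. ring.
  - intros x t _. unfold Rdiv. ring.
Qed.

(** * The immersion as a tractroid *)

(** First and second derivatives of a horizontal coordinate radius * C, where dC = - D dtheta, dD =
    C dtheta and dtheta = (m dx + F dt) / radius. Leaving C and D abstract lets one computation
    serve both horizontal coordinates. *)
Lemma revolution_component (W : R * R -> Prop) k m F C D :
  open W -> smooth W m -> smooth W F ->
  partials W C (fun x t => - D x t * (m x t / radius k x))
    (fun x t => - D x t * (F x t / radius k x)) ->
  partials W D (fun x t => C x t * (m x t / radius k x))
    (fun x t => C x t * (F x t / radius k x)) ->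
  partials W (fun x t => radius k x * C x t)
    (fun x t => - radius k x * C x t - m x t * D x t) (fun x t => - F x t * D x t) /\
  partials W (fun x t => - radius k x * C x t - m x t * D x t)
    (fun x t => radius k x * C x t + m x t * D x t - pdx m x t * D x t
                - m x t * (m x t / radius k x) * C x t)
    (fun x t => F x t * D x t - pdt m x t * D x t
                - m x t * (F x t / radius k x) * C x t) /\
  exists Xtx, partials W (fun x t => - F x t * D x t) Xtx
    (fun x t => - pdt F x t * D x t - F x t * (F x t / radius k x) * C x t).
Proof.
  intros HW Hm HF PC PD.
  pose proof (smooth_partials W m Hm) as Pm.
  pose proof (smooth_partials W F HF) as PF.
  pose proof (partials_fun_x W _ _ (fun x t _ => is_derive_radius k x)) as Pr.
  assert (R0 : forall x, radius k x <> 0).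
  { intros x. pose proof (radius_pos k x). lra. }
  split; [|split; [|eexists]].
  - apply (partials_ext _ _ _ _ _ _ (partials_mult _ _ _ _ _ _ _ Pr PC));
      intros x t Hxt; field; auto.
  - apply (partials_ext _ _ _ _ _ _ (partials_plus _ _ _ _ _ _ _
      (partials_mult _ _ _ _ _ _ _ (partials_opp _ _ _ _ Pr) PC)
      (partials_opp _ _ _ _ (partials_mult _ _ _ _ _ _ _ Pm PD))));
      intros x t Hxt; field; auto.
  - apply (partials_ext _ _ _ _ _ _
      (partials_mult _ _ _ _ _ _ _ (partials_opp _ _ _ _ PF) PD)).
    + intros; reflexivity.
    + intros x t Hxt; field; auto.
Qed.

(** The derivative X_x is m times the unit vector (- sin theta, cos theta, 0) plus the unit tangent
    of the profile, and X_t is F times the former. These two orthonormal vectors are dual to w1 and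
    w2, which gives the first form; they are also the principal directions. *)
Lemma tractroid_immersion (W : R * R -> Prop) k m F theta :
  open W -> (forall x t, W (x, t) -> k < x) -> smooth W m -> smooth W F ->
  (forall x t, W (x, t) -> F x t <> 0) ->
  partials W theta (fun x t => m x t / radius k x) (fun x t => F x t / radius k x) ->
  exists X, isometric_immersion W (OneForm m F) (OneForm (fun _ _ => 1) (fun _ _ => 0))
    (fun x _ => - slope k x / radius k x) (fun _ _ => 0)
    (fun x _ => radius k x / slope k x) X.
Proof.
  intros HW Hk Hm HF F0 Pth.
  assert (R0 : forall x, radius k x <> 0).
  { intros x. pose proof (radius_pos k x). lra. }
  assert (Sr : smooth W (fun x _ => radius k x)) by now apply smooth_radius.
  assert (Sw : smooth W (fun x _ => slope k x)) by now apply smooth_slope.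
  assert (Si : smooth W (fun x _ => / radius k x)) by (apply smooth_inv; auto).
  assert (Sth : smooth W theta).
  { apply (smooth_of_partials W _ _ _ HW Pth);
      apply (smooth_mult W _ (fun x _ => / radius k x)); auto. }
  destruct (smooth_cos_sin W theta HW Sth) as [Sc Ss].
  pose proof (partials_comp W cos (fun y => - sin y) theta _ _
    (fun x t _ => is_derive_cos (theta x t)) Pth) as Pc.
  pose proof (partials_comp W sin cos theta _ _
    (fun x t _ => is_derive_sin (theta x t)) Pth) as Ps.
  set (C := fun x t => cos (theta x t)) in *.
  set (D := fun x t => sin (theta x t)) in *.
  destruct (revolution_component W k m F C D HW Hm HF) as (P1 & P1x & [X1tx P1t]).
  { apply (partials_ext _ _ _ _ _ _ Pc); intros; unfold D; ring. }
  { apply (partials_ext _ _ _ _ _ _ Ps); intros; unfold C; ring. }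
  (* Turning by a quarter, (cos, sin) becomes (sin, - cos). *)
  destruct (revolution_component W k m F D (fun x t => - C x t) HW Hm HF)
    as (P2 & P2x & [X2tx P2t]).
  { apply (partials_ext _ _ _ _ _ _ Ps); intros; unfold C; ring. }
  { apply (partials_ext _ _ _ _ _ _ (partials_opp _ _ _ _ Pc));
      intros; unfold D; ring. }
  pose proof (partials_fun_x W _ _ (fun x t _ => is_derive_height k x)) as P3.
  pose proof (partials_fun_x W _ _ (fun x t H => is_derive_slope k x (Hk x t H))) as P3x.
  pose proof (partials_const W 0) as P3t.
  set (X := Map3 (fun x t => radius k x * C x t) (fun x t => radius k x * D x t)
    (fun x _ => height k x)).
  (* The profile has tangent (- radius, slope), hence normal (slope, radius), which is then rotated
     by theta. This orientation fixes the signs of a and c. *)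
  set (N := Map3 (fun x t => slope k x * C x t) (fun x t => slope k x * D x t)
    (fun x _ => radius k x)).
  assert (CD : forall x t, D x t * D x t + C x t * C x t = 1).
  { intros x t. apply sin2_cos2. }
  assert (W0 : forall x t, W (x, t) -> slope k x <> 0).
  { intros x t Hxt. pose proof (slope_pos k x (Hk x t Hxt)). lra. }
  exists X. split; [split|].
  - repeat split; simpl.
    + now apply smooth_mult.
    + now apply smooth_mult.
    + now apply smooth_height.
  - intros x t Hxt r s. unfold X, pdx3, pdt3. cbn [c1 c2 c3].
    rewrite (partials_pdx _ _ _ _ _ _ P1 Hxt) (partials_pdt _ _ _ _ _ _ P1 Hxt)
      (partials_pdx _ _ _ _ _ _ P2 Hxt) (partials_pdt _ _ _ _ _ _ P2 Hxt)
      (partials_pdx _ _ _ _ _ _ P3 Hxt) (partials_pdt _ _ _ _ _ _ P3 Hxt).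
    intros E1 E2 E3.
    (* X_t is horizontal, so the third component of the relation reads r * slope = 0. *)
    assert (r = 0) as ->.
    { apply (Rmult_eq_reg_r (slope k x)); eauto. lra. }
    split; auto. apply (Rmult_eq_reg_r (F x t)); auto.
    (* Projecting the relation onto (- sin theta, cos theta), the direction of X_t, isolates s *
       F. *)
    transitivity (s * F x t * (D x t * D x t + C x t * C x t)); [rewrite CD; ring|].
    transitivity (- D x t * (s * (- F x t * D x t)) + C x t * (s * (- F x t * - C x t)));
      [ring|].
    replace (s * (- F x t * D x t)) with 0 by lra.
    replace (s * (- F x t * - C x t)) with 0 by lra. ring.
  - exists N. split; [split|].
    + repeat split; simpl; auto; now apply smooth_mult.
    + intros x t Hxt. unfold dot, X, N, pdx3, pdt3. cbn [c1 c2 c3].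
      rewrite (partials_pdx _ _ _ _ _ _ P1 Hxt) (partials_pdt _ _ _ _ _ _ P1 Hxt)
        (partials_pdx _ _ _ _ _ _ P2 Hxt) (partials_pdt _ _ _ _ _ _ P2 Hxt)
        (partials_pdx _ _ _ _ _ _ P3 Hxt) (partials_pdt _ _ _ _ _ _ P3 Hxt).
      pose proof (slope_sqr k x (Hk x t Hxt)) as E. repeat split.
      * transitivity (slope k x * slope k x * (D x t * D x t + C x t * C x t)
          + radius k x * radius k x); [ring|]. rewrite CD E; ring.
      * transitivity (- slope k x * radius k x * (D x t * D x t + C x t * C x t)
          + radius k x * slope k x); [ring|]. rewrite CD; ring.
      * ring.
    + intros x t Hxt.
      unfold first_form, second_form, sym_prod, lin_comb, qplus, dot,
        X, N, pdx3, pdt3.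
      cbn [c1 c2 c3 cdx cdt].
      rewrite (partials_pdx _ _ _ _ _ _ P1 Hxt) (partials_pdt _ _ _ _ _ _ P1 Hxt)
        (partials_pdx _ _ _ _ _ _ P2 Hxt) (partials_pdt _ _ _ _ _ _ P2 Hxt)
        (partials_pdx _ _ _ _ _ _ P3 Hxt) (partials_pdt _ _ _ _ _ _ P3 Hxt)
        (partials_pdx_pdx _ _ _ _ _ _ _ _ HW P1 P1x Hxt)
        (partials_pdx_pdx _ _ _ _ _ _ _ _ HW P2 P2x Hxt)
        (partials_pdx_pdx _ _ _ _ _ _ _ _ HW P3 P3x Hxt)
        (partials_pdt_pdx _ _ _ _ _ _ _ _ HW P1 P1x Hxt)
        (partials_pdt_pdx _ _ _ _ _ _ _ _ HW P2 P2x Hxt)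
        (partials_pdt_pdx _ _ _ _ _ _ _ _ HW P3 P3x Hxt)
        (partials_pdt_pdt _ _ _ _ _ _ _ _ HW P1 P1t Hxt)
        (partials_pdt_pdt _ _ _ _ _ _ _ _ HW P2 P2t Hxt)
        (partials_pdt_pdt _ _ _ _ _ _ _ _ HW P3 P3t Hxt).
      pose proof (slope_sqr k x (Hk x t Hxt)) as E.
      pose proof (W0 x t Hxt) as w0. pose proof (R0 x) as r0.
      specialize (CD x t).
      generalize dependent (slope k x). generalize dependent (radius k x).
      intros s s0 w E w0.
      (* With [radius] and [slope] generalized to s and w, all entries are rational in s, w, sin and
         cos; Q and E eliminate sin^2 and w^2. *)
      assert (Q : D x t * D x t = 1 - C x t * C x t) by lra.
      split; f_equal; [f_equal | | f_equal |].
      all: field_simplify_eq [Q E]; auto.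
Qed.

(** * Universality of the second fundamental form *)

Lemma generalized_CH_universal :
  universal_second_form generalized_CH ch_form1 ch_form2.
Proof.
  intros x0 t0. set (k := x0 - 1).
  exists (fun p => k < fst p), (fun x _ => - slope k x / radius k x), (fun _ _ => 0),
    (fun x _ => radius k x / slope k x).
  assert (HV : open (fun p : R * R => k < fst p)).
  { apply (open_comp (fun p : R * R => fst p) (fun u => k < u)); [|apply open_gt].
    intros p _; apply: continuous_fst. }
  assert (Sr := smooth_radius _ k HV).
  assert (Sw : smooth (fun p : R * R => k < fst p) (fun x _ => slope k x)).
  { now apply smooth_slope. }
  split; [exact HV|]. split; [simpl; unfold k; lra|].
  split.
  { apply (smooth_mult _ (fun x _ => - slope k x) (fun x _ => / radius k x)); auto.
    - now apply smooth_opp.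
    - apply smooth_inv; auto. intros x t _. pose proof (radius_pos k x). lra. }
  split; [now apply smooth_const|].
  split.
  { apply (smooth_mult _ (fun x _ => radius k x) (fun x _ => / slope k x)); auto.
    apply smooth_inv; auto. intros x t Hxt. pose proof (slope_pos k x Hxt). lra. }
  intros U u [HS Hw] x1 t1 HU1 HV1.
  destruct (generalized_CH_angle U u k x1 t1 HS HU1) as (d & theta & Hd & Hbox & Pth).
  (* The angle exists on the box, while the tractroid requires x > k. *)
  exists (fun p => box x1 t1 d p /\ k < fst p).
  assert (HW : open (fun p => box x1 t1 d p /\ k < fst p)).
  { apply: open_and; auto using open_box. }
  pose proof (proj1 HS) as HU. pose proof (proj1 (proj2 HS)) as Hu.
  destruct (tractroid_immersion (fun p => box x1 t1 d p /\ k < fst p) k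
    (fun x t => momentum (jet_of u x t)) (fun x t => flux (jet_of u x t)) theta)
    as [X HX]; auto.
  - now intros x t [_ H].
  - apply (smooth_sub U); [intros p [Hp _]; auto|].
    apply (smooth_jet_poly U u 2); auto using momentum_poly.
  - apply (smooth_sub U); [intros p [Hp _]; auto|].
    apply (smooth_jet_poly U u 2); auto using flux_poly.
  (* The coefficient of w1 /\ w2 is - F, so nondegeneracy of the solution makes F nonzero. *)
  - intros x t [Hxt _] F0. apply (Hw x t (Hbox _ Hxt)).
    unfold wedge; simpl. rewrite F0. ring.
  - apply (partials_sub (box x1 t1 d)); auto. now intros p [Hp _].
  - exists X. split; [exact HW|]. split.
    + split; [split; simpl; lra | exact HV1].
    + split; [|exact HX]. intros p [Hp Hk]. auto.
Qed.

Theorem corollary1p2 :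
  exists w1 w2 w3 : jet_form,
    describes_pss generalized_CH w1 w2 w3 /\
    universal_second_form generalized_CH w1 w2.
Proof.
  exists ch_form1, ch_form2, ch_form1.
  split; [apply generalized_CH_describes_pss | apply generalized_CH_universal].
Qed.
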